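(* For all integers $n\ge0$ and $m$, the mapping $\gamma$ (applied at the columns $c=3i+1$, $0\le i\le n$) is a bijection from the set of Schröder paths (respectively Delannoy paths) from $(0,0)$ to $(3n+2,m)$ that are smooth at each horizontal distance $3i+1$ from the origin for $0\le i\le n$, to the set of vertically constrained $S_{CW}$ paths from $(0,0)$ to $(n,m)$ all of whose vertices have $y\ge0$ (respectively, with no height restriction), first step arbitrary.
   Context: A lattice path is a finite sequence of steps (vectors in $\mathbb{Z}^2$) starting at $(0,0)$; its vertices are the partial sums. Let $S_C=\{(1,1),(1,-1),(2,0)\}$. A Delannoy path is a lattice path with steps in $S_C$; a Schröder path is a Delannoy path all of whose vertices have $y\ge0$. A path is smooth at the integer column $x=c$ if either it contains a step $(2,0)$ from $(c-1,y)$ to $(c+1,y)$ for some $y$, or it has a vertex with $x$-coordinate $c$ and the step ending at that vertex equals the step starting at it (two consecutive equal steps $(1,1)(1,1)$, $(1,-1)(1,-1)$ or $(2,0)(2,0)$ meeting at $x=c$). The map $\gamma$ performs, at each designated column $c$, the substitution: $(1,1)(1,1)$ meeting at $c$ $\mapsto(0,2)$; $(1,-1)(1,-1)$ meeting at $c$ $\mapsto(0,-2)$; $(2,0)(2,0)$ meeting at $c$ $\mapsto(2,0)$; a single $(2,0)$ step with midpoint at $x=c$ is removed; all other steps are kept and the resulting steps concatenated in order. Let $S_{CW}=S_C\cup\{(0,2),(0,-2)\}$, with $(0,\pm2)$ vertical; a vertically constrained $S_{CW}$ path is a lattice path with steps in $S_{CW}$ with no two consecutive vertical steps. *)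

(* Defs.v *)
From mathcomp Require Import all_boot all_order all_algebra.
From mathcomp Require Import mathcomp_extra boolp classical_sets functions.

Set Implicit Arguments.
Unset Strict Implicit.
Unset Printing Implicit Defensive.

Import Order.TTheory GRing.Theory Num.Theory.
Local Open Scope ring_scope.

Definition step : Type := (int * int)%type.
Definition lpath : Type := seq step.

Definition up : step := (1, 1).
Definition down : step := (1, -1).
Definition level : step := (2, 0).
Definition vup : step := (0, 2).
Definition vdown : step := (0, -2).

Definition S_C : seq step := [:: up; down; level].
Definition S_CW : seq step := S_C ++ [:: vup; vdown].

Definition vertices (p : lpath) : seq (int * int) := 0 :: scanl +%R 0 p.
Definition endpoint (p : lpath) : int * int := last 0 (vertices p).

Definition nonneg_height (p : lpath) : bool :=
  all (fun v : int * int => 0 <= v.2) (vertices p).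

Definition delannoy_path (p : lpath) : bool := all (mem S_C) p.
Definition schroder_path (p : lpath) : bool :=
  delannoy_path p && nonneg_height p.

Definition smooth_at (p : lpath) (c : int) : Prop :=
  (exists q r : lpath,
      p = q ++ level :: r /\ (endpoint q).1 = c - 1)
  \/ (exists (q r : lpath) (s : step),
      p = q ++ s :: s :: r /\ (endpoint (rcons q s)).1 = c).

Definition vertical (s : step) : bool := s \in [:: vup; vdown].

Definition vconstrained_path (p : lpath) : bool :=
  all (mem S_CW) p && sorted (fun s t => ~~ (vertical s && vertical t)) p.

(* What replaces two consecutive copies of s in S_C meeting at a designated
   column; the value on steps outside S_C is irrelevant. *)
Definition merge_step (s : step) : step :=
  if s == up then vup else if s == down then vdown else level.

(* x is the abscissa at which the remaining path p starts; cs lists the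
   designated columns. Patterns are replaced from left to right; in an S_C
   path, patterns at columns at distance at least 3 (such as the 3i+1) have no
   common step, so the order of the substitutions is immaterial. *)
Fixpoint gamma_from (cs : seq int) (x : int) (p : lpath) : lpath :=
  match p with
  | [::] => [::]
  | s :: p1 =>
      if (s == level) && (x + 1 \in cs) then gamma_from cs (x + 2) p1
      else match p1 with
           | [::] => [:: s]
           | t :: p2 =>
               if (s == t) && (x + s.1 \in cs)
               then merge_step s :: gamma_from cs (x + s.1 + t.1) p2
               else s :: gamma_from cs (x + s.1) p1
           end
  end.

Definition gamma (cs : seq int) (p : lpath) : lpath := gamma_from cs 0 p.

Definition columns (n : nat) : seq int :=
  [seq (3 * i + 1)%N%:Z | i <- iota 0 n.+1].

(* Main.v *)
(* Cut a smooth path of length 3n+2 at the abscissas 3i and 3i+2. Smoothness at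
   3i+1 forces the part over [3i, 3i+2] to be (1,1)(1,1), (1,-1)(1,-1) or (2,0),
   and forces the part over [3i+2, 3i+3] to be a single step (1,1) or (1,-1),
   unless a pair (2,0)(2,0) covers [3i+2, 3i+6]. Under gamma the parts of the
   first kind become a vertical step or nothing, the others become the steps of
   S_C, so the image is an alternation of optional vertical steps and S_C steps,
   i.e. an arbitrary vertically constrained path. The inverse is [expand]. *)

Require Import Defs.
From mathcomp Require Import all_boot all_order all_algebra.
From mathcomp Require Import mathcomp_extra boolp classical_sets functions.
From mathcomp Require Import zify.

Import Defs.
Import Order.TTheory GRing.Theory Num.Theory.
Local Open Scope classical_set_scope.
Local Open Scope ring_scope.

(** * Step sets, endpoints and heights, read one step at a time *)

Lemma S_C_P (s : step) :
  reflect [\/ s = up, s = down | s = level] (s \in S_C).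
Proof.
rewrite !inE; apply: (iffP or3P).
  by case=> /eqP->; [constructor 1|constructor 2|constructor 3].
by case=> ->; rewrite eqxx; [constructor 1|constructor 2|constructor 3].
Qed.

Lemma S_CW_E (s : step) : (s \in S_CW) = (s \in S_C) || vertical s.
Proof. by rewrite mem_cat. Qed.

Lemma verticalP (s : step) : reflect (s = vup \/ s = vdown) (vertical s).
Proof.
rewrite /vertical !inE; apply: (iffP orP); first by case=> /eqP->; [left|right].
by case=> ->; rewrite eqxx; [left|right].
Qed.

Lemma scanl_shift (a : int * int) (p : lpath) :
  scanl +%R a p = [seq a + v | v <- scanl +%R 0 p].
Proof.
elim: p a => [//|s p IH] a /=.
rewrite add0r (IH (a + s)) (IH s) -map_comp; congr (_ :: _).
by apply: eq_map => v /=; rewrite addrA.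
Qed.

Lemma vertices_cons (s : step) (p : lpath) :
  vertices (s :: p) = 0 :: [seq s + v | v <- vertices p].
Proof.
rewrite /vertices map_cons addr0 -scanl_shift.
by rewrite -[X in _ = [:: _, X & _]]add0r -[X in scanl _ X p]add0r.
Qed.

Lemma endpoint_cons (s : step) (p : lpath) :
  endpoint (s :: p) = s + endpoint p.
Proof. by rewrite /endpoint vertices_cons map_cons !last_cons last_map. Qed.

Lemma endpoint1_cons (s : step) (p : lpath) :
  (endpoint (s :: p)).1 = s.1 + (endpoint p).1.
Proof. by rewrite endpoint_cons. Qed.

Lemma endpoint2_cons (s : step) (p : lpath) :
  (endpoint (s :: p)).2 = s.2 + (endpoint p).2.
Proof. by rewrite endpoint_cons. Qed.

(** The explicit starting height lets inductions on the path pass to the tail. *)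
Fixpoint nonneg_from (y : int) (p : lpath) : bool :=
  (0 <= y) && (if p is s :: p' then nonneg_from (y + s.2) p' else true).

Lemma nonneg_from_ge0 (y : int) (p : lpath) : nonneg_from y p -> 0 <= y.
Proof. by case: p => [|s p] /= /andP[]. Qed.

Lemma nonneg_height_from (p : lpath) : nonneg_height p = nonneg_from 0 p.
Proof.
suff H y : all (fun v : int * int => 0 <= y + v.2) (vertices p) = nonneg_from y p.
  by rewrite /nonneg_height -H; apply: eq_all => v; rewrite add0r.
elim: p y => [|s p IH] y; first by rewrite /= addr0.
rewrite vertices_cons; move: (vertices p) IH => V IH.
rewrite /= addr0 -IH all_map; congr (_ && _).
by apply: eq_all => v /=; rewrite addrA.
Qed.

Lemma delannoy_endpoint_ge0 (p : lpath) :
  delannoy_path p -> 0 <= (endpoint p).1.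
Proof.
elim: p => [//|s p IH] /= /andP[sC /IH]; rewrite endpoint1_cons.
by case/S_C_P: sC => -> /=; lia.
Qed.

(** * Smoothness and the designated columns *)

(** The first step can only produce smoothness at its midpoint or at its end; any other occurrence
    lies in the tail, whose abscissas are counted from [s.1]. *)
Lemma smooth_at_cons (s : step) (p : lpath) (c : int) :
  smooth_at (s :: p) c <->
  [\/ s = level /\ c = 1, ohead p = Some s /\ c = s.1
    | smooth_at p (c - s.1)].
Proof.
split.
- case=> [[[|s' q] [r [[-> ->] e]]]|[[|s' q] [r [t [[-> ->] e]]]]].
  + by constructor 1; split=> //; move: e; rewrite /endpoint /=; lia.
  + constructor 3; left; exists q, r; split=> //.
    by move: e; rewrite endpoint1_cons; lia.
  + by constructor 2; split=> //; rewrite -e -[rcons _ _]/([:: t]) endpoint1_cons addr0.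
  + constructor 3; right; exists q, r, t; split=> //.
    by move: e; rewrite rcons_cons endpoint1_cons; lia.
- case=> [[-> ->]|[+ ->]|[[q [r [-> e]]]|[q [r [t [-> e]]]]]].
  + by left; exists [::], p.
  + case: p => [//|t p] [->]; right; exists [::], p, s.
    by rewrite -[rcons _ _]/([:: s]) endpoint1_cons addr0.
  + by left; exists (s :: q), r; split=> //; rewrite endpoint1_cons; lia.
  + right; exists (s :: q), r, t; split=> //.
    by rewrite rcons_cons endpoint1_cons; lia.
Qed.

Lemma smooth_at_gt0 (p : lpath) (c : int) :
  delannoy_path p -> smooth_at p c -> 0 < c.
Proof.
elim: p c => [|s p IH] c.
  by move=> _ [[[|? ?] [r []]]|[[|? ?] [r [t []]]]].
move=> /= /andP[sC /IH{}IH] /smooth_at_cons[[_ ->//]|[_ ->]|/IH].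
  by case/S_C_P: sC => ->.
by case/S_C_P: sC => -> /=; lia.
Qed.

(** The two inequalities rule out the midpoint and the end of the first step. *)
Lemma smooth_at_behead (s : step) (p : lpath) (c : int) :
  smooth_at (s :: p) c -> 1 < c -> s.1 < c -> smooth_at p (c - s.1).
Proof. by move=> /smooth_at_cons[[_ ->//]|[_ ->]|//]; rewrite ltxx. Qed.

Lemma columnsP (n k : nat) : ((3 * k + 1)%N%:Z \in columns n) = (k <= n)%N.
Proof.
apply/mapP/idP => [[i]|kn]; first by rewrite mem_iota => ? [?]; lia.
by exists k => //; rewrite mem_iota; lia.
Qed.

Lemma columnsN (n k j : nat) : (j < 3)%N -> j != 1%N ->
  ((3 * k + j)%N%:Z \in columns n) = false.
Proof. by move=> ? ?; apply/negP => /mapP[i _ [?]]; lia. Qed.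

(** * Vertically constrained paths and their expansion *)

(* [b] records whether a vertical step is allowed first. *)
Fixpoint vconstrained_from (b : bool) (q : lpath) : bool :=
  if q is s :: q' then
    [&& s \in S_CW, vertical s ==> b & vconstrained_from (~~ vertical s) q']
  else true.

Lemma vconstrained_pathE (q : lpath) :
  vconstrained_path q = vconstrained_from true q.
Proof.
have H s : all (mem S_CW) q &&
    path (fun s t => ~~ (vertical s && vertical t)) s q =
    vconstrained_from (~~ vertical s) q.
  elim: q s => [//|t q IH] s /=; rewrite -IH.
  by case: (t \in _); case: (vertical s); case: (vertical t); rewrite ?andbF.
(* As a fictitious predecessor, [level] is not vertical and so forbids nothing. *)
by rewrite -(H level); congr (_ && _); case: q {H}.
Qed.

Definition half_step (s : step) : step := if s == vup then up else down.

(* [b] holds if the expanded path starts at an abscissa 3k, and fails if it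
   starts at an abscissa 3k+2. *)
Fixpoint expand (b : bool) (q : lpath) : lpath :=
  if q is s :: q' then
    if vertical s then half_step s :: half_step s :: expand false q'
    else (if b then [:: level] else [::]) ++
         (if s == level then [:: level; level] else [:: s]) ++ expand true q'
  else if b then [:: level] else [::].

Lemma vconstrained_fromW (q : lpath) :
  vconstrained_from false q -> vconstrained_from true q.
Proof. by case: q => //= s q /and3P[-> _ ->]; rewrite implybT. Qed.

Lemma expand_true (q : lpath) : vconstrained_from false q ->
  expand true q = level :: expand false q.
Proof. by case: q => //= s q; case: (vertical s); rewrite ?andbF. Qed.

(** One case for each piece of the expanded path: the end, a level step over [3k, 3k+2], two half
    steps there, a diagonal step over [3k+2, 3k+3], two level steps over [3k+2, 3k+6]. The second
    case changes the flag and leaves [q] alone, so this is not plain list induction. *)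
Lemma vconstrained_ind (P : bool -> lpath -> Prop) :
  P false [::] ->
  (forall q, vconstrained_from false q -> P false q -> P true q) ->
  (forall s q, vertical s -> P false q -> P true (s :: q)) ->
  (forall s q, s \in S_C -> s != level -> P true q -> P false (s :: q)) ->
  (forall q, P true q -> P false (level :: q)) ->
  forall b q, vconstrained_from b q -> P b q.
Proof.
move=> P0 Pl Pv Pg PL b q; elim: q b => [|s q IH] b.
  by case: b => // _; apply: Pl.
have F : vertical s = false -> vconstrained_from false (s :: q) ->
    P false (s :: q).
  move=> vs /and3P[]; rewrite S_CW_E vs orbF => sC _ /IH Pq.
  by case: (eqVneq s level) => [->|sl]; [exact: PL|exact: Pg].
case vs: (vertical s); case: b => //=; rewrite ?vs /= ?andbF //.
- by case/andP=> _ /IH Pq; apply: Pv.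
- move=> sq; have H : vconstrained_from false (s :: q) by rewrite /= vs.
  by apply: Pl => //; exact: F.
- by move=> sq; apply: F => //=; rewrite vs.
Qed.

Lemma expand_vertical (b : bool) (s : step) (q : lpath) : vertical s ->
  expand b (s :: q) = half_step s :: half_step s :: expand false q.
Proof. by move=> /= ->. Qed.

Lemma expand_diagonal (s : step) (q : lpath) : s \in S_C -> s != level ->
  expand false (s :: q) = s :: expand true q.
Proof. by case/S_C_P => ->. Qed.

Lemma expand_level (q : lpath) :
  expand false (level :: q) = level :: level :: expand true q.
Proof. by []. Qed.

Lemma gamma_from_keep (cs : seq int) (x : int) (s : step) (p : lpath) :
  (s == level) && (x + 1 \in cs) = false -> (x + s.1 \in cs) = false ->
  gamma_from cs x (s :: p) = s :: gamma_from cs (x + s.1) p.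
Proof. by move=> h1 h2 /=; rewrite h1; case: p => [//|t p]; rewrite h2 andbF. Qed.

(** * Endpoint, heights and smoothness of an expansion *)

(** Each step of [S_C], together with the piece of width 2 that follows it, triples in width: 1+2
    for a diagonal step, 4+2 for a level one. The flag [true] adds one piece of width 2 in front. *)
Lemma expand_endpoint (b : bool) (q : lpath) : vconstrained_from b q ->
  (endpoint (expand b q)).1 = 3 * (endpoint q).1 + (2 * b)%N%:Z
  /\ (endpoint (expand b q)).2 = (endpoint q).2.
Proof.
move: b q; apply: vconstrained_ind => [//|q vq IH|s q vs IH|s q sC sl IH|q IH].
- by rewrite expand_true // endpoint1_cons endpoint2_cons /=; lia.
- rewrite expand_vertical // !endpoint1_cons !endpoint2_cons.
  by case/verticalP: vs => -> /=; lia.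
- rewrite expand_diagonal // !endpoint1_cons !endpoint2_cons.
  by case/S_C_P: sC sl => -> //= _; lia.
- by rewrite expand_level !endpoint1_cons !endpoint2_cons /=; lia.
Qed.

Lemma expand_delannoy (b : bool) (q : lpath) : vconstrained_from b q ->
  delannoy_path (expand b q).
Proof.
move: b q; apply: vconstrained_ind => [//|q vq IH|s q vs IH|s q sC sl IH|//].
- by rewrite expand_true.
- by rewrite expand_vertical //; case/verticalP: vs => ->.
- by rewrite expand_diagonal //= sC.
Qed.

Lemma vconstrained_endpoint_ge0 (b : bool) (q : lpath) :
  vconstrained_from b q -> 0 <= (endpoint q).1.
Proof.
move=> vq; have := delannoy_endpoint_ge0 _ (expand_delannoy _ _ vq).
by case: (expand_endpoint _ _ vq) => -> _; case: b {vq} => /=; lia.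
Qed.

(* The midpoints created by [half_step] lie between the two ends of the
   vertical step, so they do not affect nonnegativity. *)
Lemma expand_nonneg (b : bool) (q : lpath) (y : int) : vconstrained_from b q ->
  nonneg_from y (expand b q) = nonneg_from y q.
Proof.
move=> vq; move: b q vq y.
apply: vconstrained_ind => [//|q vq IH|s q vs IH|s q sC sl IH|q IH] y.
- rewrite expand_true //= addr0 IH; apply/andb_idl; exact: nonneg_from_ge0.
- rewrite expand_vertical //= IH -addrA.
  have -> : (half_step s).2 + (half_step s).2 = s.2.
    by case/verticalP: vs => ->.
  case y0: (0 <= y) => //=; apply/andb_idl => /nonneg_from_ge0.
  by move: y0; case/verticalP: vs => -> /=; lia.
- by rewrite expand_diagonal //= IH.
- by rewrite expand_level /= !addr0 IH; case: (0 <= y).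
Qed.

(** Counted from the start, the designated columns are 1, 4, ... if the start is 3k and 2, 5, ... if
    it is 3k+2. A diagonal piece meets none of them, so [i] is kept there; every other nonempty
    piece accounts for exactly one. *)
Lemma expand_smooth (b : bool) (q : lpath) (i : nat) : vconstrained_from b q ->
  i%:Z < (endpoint q).1 + b%:Z ->
  smooth_at (expand b q) (3 * i + 2 - b)%N%:Z.
Proof.
move=> vq; move: b q vq i.
apply: vconstrained_ind => [|q vq IH|s q vs IH|s q sC sl IH|q IH] i.
- by rewrite /endpoint /=; lia.
- rewrite expand_true //= => iq; apply/smooth_at_cons; case: i iq => [|i] iq.
    by constructor 1.
  constructor 3; have := IH i; rewrite /= addr0 => /(_ ltac:(lia)).
  by congr smooth_at; lia.
- rewrite expand_vertical // endpoint1_cons /= => iq.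
  have h1 : (half_step s).1 = 1 by case/verticalP: vs {iq} => ->.
  apply/smooth_at_cons; case: i iq => [|i] iq.
    by constructor 2; rewrite h1.
  constructor 3; apply/smooth_at_cons; constructor 3; rewrite h1.
  have := IH i => /(_ ltac:(by move: iq; case/verticalP: vs => -> /=; lia)).
  by congr smooth_at; lia.
- rewrite expand_diagonal // endpoint1_cons => iq.
  have s1 : s.1 = 1 by case/S_C_P: sC sl {iq} => ->.
  apply/smooth_at_cons; constructor 3; rewrite s1.
  have := IH i => /(_ ltac:(move: iq; rewrite s1 /=; lia)).
  by congr smooth_at; lia.
- rewrite expand_level endpoint1_cons /= => iq.
  apply/smooth_at_cons; case: i iq => [|i] iq; first by constructor 2.
  constructor 3; apply/smooth_at_cons; constructor 3 => /=.
  have := IH i => /(_ ltac:(move: iq; rewrite /=; lia)).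
  by congr smooth_at; lia.
Qed.

(** * [gamma] undoes [expand] *)

(** The remaining width n-k is nonnegative, which places each column 3k+1 that is met among
    [columns n]. *)
Lemma gamma_expand_from (n k : nat) (b : bool) (q : lpath) :
  vconstrained_from b q -> k%:Z + (endpoint q).1 = n%:Z ->
  gamma_from (columns n) (3 * k + 2 * ~~ b)%N%:Z (expand b q) = q.
Proof.
move=> vq; have := vq; move: b q vq k.
apply: vconstrained_ind => [//|q vq IH|s q vs IH|s q sC sl IH|q IH] k vsq.
- move=> kq; rewrite expand_true //=; have q0 := vconstrained_endpoint_ge0 _ _ vq.
  have -> : (3 * k + 2 * 0)%N%:Z + 1 = (3 * k + 1)%N%:Z by lia.
  rewrite columnsP (_ : (k <= n)%N); last by lia.
  by rewrite -[RHS](IH k) //=; congr gamma_from; lia.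
- case/and3P: vsq => _ _; rewrite vs => vq; rewrite endpoint1_cons => kq.
  have q0 := vconstrained_endpoint_ge0 _ _ vq.
  have s0 : s.1 = 0 by case/verticalP: vs {kq} => ->.
  have h1 : (half_step s).1 = 1 by case/verticalP: vs {kq} => ->.
  have hl : (half_step s == level) = false by case/verticalP: vs {kq} => ->.
  have ms : merge_step (half_step s) = s by case/verticalP: vs {kq} => ->.
  rewrite expand_vertical //= hl /= eqxx h1 ms.
  have -> : (3 * k + 2 * 0)%N%:Z + 1 = (3 * k + 1)%N%:Z by lia.
  rewrite columnsP (_ : (k <= n)%N); last by lia.
  congr (_ :: _); rewrite -[RHS](IH k) //=; last by lia.
  by congr gamma_from; lia.
- have vs : vertical s = false by case/S_C_P: sC sl {vsq} => ->.
  case/and3P: vsq => _ _; rewrite vs => vq; rewrite endpoint1_cons => kq.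
  have s1 : s.1 = 1 by case/S_C_P: sC sl {kq vs} => ->.
  rewrite expand_diagonal // gamma_from_keep ?(negbTE sl) // s1; last first.
    by rewrite -[RHS](columnsN n k.+1 0 isT isT); congr in_mem; lia.
  congr (_ :: _); rewrite -[RHS](IH k.+1) //=; last by rewrite s1 in kq; lia.
  by congr gamma_from; lia.
- case/and3P: vsq => _ _ vq; rewrite endpoint1_cons /= => kq.
  have q0 := vconstrained_endpoint_ge0 _ _ vq.
  (* The first level step has midpoint 3k+3 and is not removed; the pair meets at 3(k+1)+1 and is
     merged. *)
  have -> : ((3 * k + 2 * 1)%N%:Z + 1 \in columns n) = false.
    by rewrite -[RHS](columnsN n k.+1 0 isT isT); congr in_mem; lia.
  have -> : (3 * k + 2 * 1)%N%:Z + 2 = (3 * k.+1 + 1)%N%:Z by lia.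
  rewrite columnsP (_ : (k.+1 <= n)%N); last by lia.
  rewrite (_ : (3 * k.+1 + 1)%N%:Z + 2 = (3 * k.+2 + 2 * ~~ true)%N%:Z); last by lia.
  by rewrite IH //; lia.
Qed.

(** * Every smooth path is an expansion *)

(** Except for a diagonal step from 3k+2, the first piece is dictated by the first designated
    column: otherwise the tail would be smooth at a column at most 0, against [smooth_at_gt0]. A
    piece may take two steps, hence strong induction on the length. *)
Lemma smooth_expand (b : bool) (n : nat) (p : lpath) :
  delannoy_path p -> (endpoint p).1 = (3 * n + 2 * b)%N%:Z ->
  (forall i : nat, (i < n + b)%N -> smooth_at p (3 * i + 2 - b)%N%:Z) ->
  exists2 q, vconstrained_from b q & p = expand b q.
Proof.
have [N] := ubnP (size p); elim: N => // N IH in b n p *; rewrite ltnS => pN.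
case: b => /=.
- case: p pN => [|s p] pN; first by rewrite /endpoint /=; lia.
  move=> /= /andP[sC pC]; rewrite endpoint1_cons => en sm.
  have /smooth_at_cons[[sl _]|[]|] := sm 0%N ltac:(lia).
  + subst s; have [//||i ni|q vq eq] := IH false n p _ pC.
    * by move: en => /=; lia.
    * have := sm i.+1 ltac:(lia).
      move=> /smooth_at_behead/(_ ltac:(lia) ltac:(move=> /=; lia)).
      by congr smooth_at => /=; lia.
    by exists q; [exact: vconstrained_fromW|rewrite expand_true // eq].
  + case: p pN pC en sm => [//|t p] pN /= /andP[_ pC] + sm [ts] s1.
    subst t; rewrite endpoint1_cons => en.
    have [||i ni|q vq eq] := IH false n p _ pC.
    * by move: pN => /=; lia.
    * by move: en => /=; lia.
    * have := sm i.+1 ltac:(lia).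
      (* Past two steps of width 1, column 3(i+1)+1 becomes 3i+2. *)
      do 2!move=> /smooth_at_behead/(_ ltac:(lia) ltac:(lia)).
      by congr smooth_at => /=; lia.
    (* Width 1 excludes [level], so [s] is [up] or [down]. *)
    pose v := if s == up then vup else vdown.
    have vv : vertical v by rewrite /v; case: ifP.
    have hv : half_step v = s by rewrite /v; case/S_C_P: sC s1 => ->.
    exists (v :: q); last by rewrite expand_vertical // hv eq.
    by rewrite /= S_CW_E vv orbT.
  + move=> /(smooth_at_gt0 _ _ pC).
    by case/S_C_P: sC => -> /=; lia.
- case: p pN => [|s p] pN; first by exists [::].
  move=> /= /andP[sC pC]; rewrite endpoint1_cons => en sm.
  have p0 := delannoy_endpoint_ge0 _ pC.
  case: n en sm => [|n] en sm.
    by move: en; case/S_C_P: sC => -> /=; lia.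
  have [sl|sl] := eqVneq s level; last first.
    have s1 : s.1 = 1 by case/S_C_P: sC sl {en sm} => ->.
    have [//||i ni|q vq eq] := IH true n p _ pC.
    + by move: en => /=; lia.
    + have := sm i ltac:(lia).
      move=> /smooth_at_behead/(_ ltac:(lia) ltac:(lia)).
      by congr smooth_at => /=; lia.
    have vs : vertical s = false by case/S_C_P: sC sl {en s1 sm} => ->.
    exists (s :: q); last by rewrite expand_diagonal // eq.
    by rewrite /= S_CW_E sC vs.
  (* Column 2 is the end of this level step, not its midpoint, so a second level step must
     follow. *)
  subst s; have /smooth_at_cons[[_ /=]|[]|] := sm 0%N ltac:(lia).
  + by lia.
  + case: p pN pC en sm {p0} => [//|t p] pN /= /andP[_ pC] + sm [ts] _.
    subst t; rewrite endpoint1_cons /= => en.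
    have p0 := delannoy_endpoint_ge0 _ pC.
    (* Two level steps have width 4, which exceeds 3. *)
    case: n en sm => [|n] en sm; first by lia.
    have [||i ni|q vq eq] := IH true n p _ pC.
    * by move: pN => /=; lia.
    * by move: en => /=; lia.
    * have := sm i.+1 ltac:(lia).
      do 2!move=> /smooth_at_behead/(_ ltac:(move=> /=; lia) ltac:(move=> /=; lia)).
      by congr smooth_at => /=; lia.
    by exists (level :: q); rewrite ?expand_level ?eq.
  + by move=> /(smooth_at_gt0 _ _ pC) /=; lia.
Qed.

(** * The two bijections *)

Lemma gamma_expand (n : nat) (q : lpath) :
  vconstrained_path q -> (endpoint q).1 = n%:Z ->
  gamma (columns n) (expand true q) = q.
Proof.
rewrite vconstrained_pathE => vq en.
by apply: (gamma_expand_from n 0 true) => //; rewrite en add0r.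
Qed.

(** Once the Delannoy domain is the image of [expand true], [gamma_expand] gives the values,
    injectivity and surjectivity of [gamma]. *)
Lemma smooth_pathP (n : nat) (m : int) (p : lpath) :
  [/\ delannoy_path p, endpoint p = ((3 * n + 2)%N%:Z, m)
    & forall i : nat, (i <= n)%N -> smooth_at p (3 * i + 1)%N%:Z] <->
  exists2 q, vconstrained_path q /\ endpoint q = (n%:Z, m)
    & p = expand true q.
Proof.
split=> [[pC ep sm]|[q [+ eq] ->]].
- have [|i ni|q vq pq] := smooth_expand true n p pC.
  + by rewrite ep muln1.
  + by have := sm i ltac:(lia); congr smooth_at; lia.
  exists q => //; rewrite vconstrained_pathE; split=> //.
  have := expand_endpoint _ _ vq; rewrite -pq ep /=.
  by case: (endpoint q) => a b /= [? ->]; congr (_, _); lia.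
- rewrite vconstrained_pathE => vq; split.
  + exact: expand_delannoy.
  + have := expand_endpoint _ _ vq; rewrite eq.
    by case: (endpoint _) => a b /= [-> ->]; congr (_, _); lia.
  + move=> i ni; have := expand_smooth _ _ i vq; rewrite eq /=.
    by move=> /(_ ltac:(lia)); congr smooth_at; lia.
Qed.

Theorem theorem21 (n : nat) (m : int) :
  set_bij
    [set p : lpath | [/\ schroder_path p,
                         endpoint p = ((3 * n + 2)%N%:Z, m)
                       & forall i : nat, (i <= n)%N ->
                           smooth_at p (3 * i + 1)%N%:Z]]
    [set q : lpath | [/\ vconstrained_path q,
                         nonneg_height q
                       & endpoint q = (n%:Z, m)]]
    (gamma (columns n))
  /\
  set_bij
    [set p : lpath | [/\ delannoy_path p,
                         endpoint p = ((3 * n + 2)%N%:Z, m)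
                       & forall i : nat, (i <= n)%N ->
                           smooth_at p (3 * i + 1)%N%:Z]]
    [set q : lpath | vconstrained_path q /\ endpoint q = (n%:Z, m)]
    (gamma (columns n)).
Proof.
have gK q : vconstrained_path q -> endpoint q = (n%:Z, m) ->
    gamma (columns n) (expand true q) = q.
  by move=> vq eq; apply: gamma_expand => //; rewrite eq.
(* Expansion preserves and reflects nonnegativity, so the Schröder case restricts the Delannoy
   one. *)
have nnE q : vconstrained_path q ->
    nonneg_height (expand true q) = nonneg_height q.
  by rewrite vconstrained_pathE => vq; rewrite !nonneg_height_from expand_nonneg.
have schroderP p : [/\ schroder_path p, endpoint p = ((3 * n + 2)%N%:Z, m)
      & forall i : nat, (i <= n)%N -> smooth_at p (3 * i + 1)%N%:Z] <->
    exists2 q, [/\ vconstrained_path q, nonneg_height q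
      & endpoint q = (n%:Z, m)] & p = expand true q.
  split=> [[/andP[pC pn] ep sm]|[q [vq qn eq] pq]].
    have /smooth_pathP[q [vq eq] pq] := And3 pC ep sm.
    by exists q => //; split=> //; rewrite -nnE // -pq.
  have /smooth_pathP[pC ep sm] : exists2 q,
      vconstrained_path q /\ endpoint q = (n%:Z, m) & p = expand true q.
    by exists q.
  by split=> //; rewrite /schroder_path pC pq nnE.
split; split.
- by move=> p /= /schroderP[q [vq qn eq] ->]; rewrite gK.
(* Both arguments are expansions, and [gamma] returns the paths they expand. *)
- move=> p p' /set_mem/= /schroderP[q [vq _ eq] ->].
  by move=> /set_mem/= /schroderP[q' [vq' _ eq'] ->]; rewrite !gK // => ->.
- move=> q /= [vq qn eq]; exists (expand true q); last exact: gK.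
  by apply/schroderP; exists q.
- by move=> p /= /smooth_pathP[q [vq eq] ->]; rewrite gK.
- move=> p p' /set_mem/= /smooth_pathP[q [vq eq] ->].
  by move=> /set_mem/= /smooth_pathP[q' [vq' eq'] ->]; rewrite !gK // => ->.
- move=> q /= [vq eq]; exists (expand true q); last exact: gK.
  by apply/smooth_pathP; exists q.
Qed.
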